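(* Let $\mathcal{A}$ be an abelian category. Let $M=\bigoplus_{i\in I}M_i$ be a direct sum decomposition of an object $M$ of $\mathcal{A}$. Then $M$ is strongly self-regular if and only if $M_i$ is strongly self-regular for every $i\in I$, and ${\rm Hom}_{\mathcal{A}}(M_i,M_j)=0$ for every $i,j\in I$ with $i\neq j$.
   Context: A direct summand $K$ of an object $X$ of an abelian category, with inclusion $k:K\to X$, is fully invariant if for every endomorphism $h:X\to X$ there is a morphism $\alpha:K\to K$ with $hk=k\alpha$ (i.e. $h(K)\subseteq K$). An object $N$ of an abelian category is strongly self-regular if for every morphism $f:N\to N$, both ${\rm Ker}(f)$ and ${\rm Im}(f)$ are fully invariant direct summands of $N$.
   Formalization: For infinite I, ''direct sum'' also requires that a morphism into M be determined by its components along the projections M → M_i (automatic for finite I and in AB5 categories); without it the claim fails, e.g. for Q and all F_p in the opposite of abelian groups. *)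

(* Defs.v *)
From mathcomp Require Import all_boot all_order all_algebra.
Set Implicit Arguments.
Unset Strict Implicit.
Unset Printing Implicit Defensive.
Import GRing.Theory.
Local Open Scope ring_scope.

(* Categories enriched over abelian groups.  [compm g f] is g after f. *)
Record preadditiveCat := PreadditiveCat {
  obj :> Type;
  mor : obj -> obj -> zmodType;
  idmor : forall X, mor X X;
  compm : forall X Y Z, mor Y Z -> mor X Y -> mor X Z;
  compmA : forall X Y Z W (h : mor Z W) (g : mor Y Z) (f : mor X Y),
    compm h (compm g f) = compm (compm h g) f;
  compm1l : forall X Y (f : mor X Y), compm (idmor Y) f = f;
  compm1r : forall X Y (f : mor X Y), compm f (idmor X) = f;
  compmDl : forall X Y Z (g g' : mor Y Z) (f : mor X Y),
    compm (g + g') f = compm g f + compm g' f;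
  compmDr : forall X Y Z (g : mor Y Z) (f f' : mor X Y),
    compm g (f + f') = compm g f + compm g f'
}.

Arguments idmor {p} X.
Arguments compm {p X Y Z} g f.

Notation "g \c f" := (compm g f) (at level 40, left associativity).

Section Preadditive.
Variable A : preadditiveCat.
Implicit Types X Y Z K C : A.

Definition is_mono X Y (f : mor X Y) : Prop :=
  forall Z (u v : mor Z X), f \c u = f \c v -> u = v.

Definition is_epi X Y (f : mor X Y) : Prop :=
  forall Z (u v : mor Y Z), u \c f = v \c f -> u = v.

Definition zero_object Z : Prop :=
  (forall X (f : mor X Z), f = 0) /\ (forall X (f : mor Z X), f = 0).

Definition is_biproduct X Y S (i : mor X S) (j : mor Y S)
    (p : mor S X) (q : mor S Y) : Prop :=
  [/\ p \c i = idmor X, q \c j = idmor Y, p \c j = 0, q \c i = 0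
    & i \c p + j \c q = idmor S].

Definition is_kernel X Y (f : mor X Y) K (k : mor K X) : Prop :=
  f \c k = 0 /\
  forall Z (g : mor Z X), f \c g = 0 -> exists! u : mor Z K, k \c u = g.

Definition is_cokernel X Y (f : mor X Y) C (c : mor Y C) : Prop :=
  c \c f = 0 /\
  forall Z (g : mor Y Z), g \c f = 0 -> exists! u : mor C Z, u \c c = g.

Definition is_image X Y (f : mor X Y) K (m : mor K Y) : Prop :=
  exists C (c : mor Y C), is_cokernel f c /\ is_kernel c m.

Definition is_coproduct (I : Type) (M_ : I -> A) (M : A)
    (iota : forall i, mor (M_ i) M) : Prop :=
  forall Z (f : forall i, mor (M_ i) Z),
    exists! g : mor M Z, forall i, g \c iota i = f i.

Definition is_projection (I : Type) (M_ : I -> A) (M : A)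
    (iota : forall i, mor (M_ i) M) (i : I) (p : mor M (M_ i)) : Prop :=
  p \c iota i = idmor (M_ i) /\ forall j, j <> i -> p \c iota j = 0.

(* The second clause, that a morphism into M is determined by its components, *)
(* is automatic when I is finite (see [finite_coproduct_direct_sum]) and, for *)
(* every I, in module and Grothendieck categories.  It may fail for infinite  *)
(* coproducts of a general abelian category: in the opposite of the category  *)
(* of abelian groups these are the products of abelian groups.                *)
Definition is_direct_sum (I : Type) (M_ : I -> A) (M : A)
    (iota : forall i, mor (M_ i) M) : Prop :=
  is_coproduct iota /\
  forall Z (x y : mor Z M),
    (forall i (p : mor M (M_ i)), is_projection iota p -> p \c x = p \c y) ->
    x = y.

Definition is_direct_summand X K (k : mor K X) : Prop :=
  exists (L : A) (l : mor L X) (p : mor X K) (q : mor X L),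
    is_biproduct k l p q.

Definition is_fully_invariant X K (k : mor K X) : Prop :=
  forall h : mor X X, exists a : mor K K, h \c k = k \c a.

(* Kernels and images are unique up to isomorphism, so quantifying over all   *)
(* of them amounts to choosing one.                                           *)
Definition strongly_self_regular (N : A) : Prop :=
  forall f : mor N N,
    (forall K (k : mor K N), is_kernel f k ->
       is_direct_summand k /\ is_fully_invariant k) /\
    (forall K (m : mor K N), is_image f m ->
       is_direct_summand m /\ is_fully_invariant m).

End Preadditive.

Record abelianCat := AbelianCat {
  abelian_preadditive :> preadditiveCat;
  has_zero_object : exists Z : abelian_preadditive, zero_object Z;
  has_biproducts : forall X Y : abelian_preadditive,
    exists (S : abelian_preadditive) (i : mor X S) (j : mor Y S)
      (p : mor S X) (q : mor S Y), is_biproduct i j p q;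
  has_kernels : forall (X Y : abelian_preadditive) (f : mor X Y),
    exists (K : abelian_preadditive) (k : mor K X), is_kernel f k;
  has_cokernels : forall (X Y : abelian_preadditive) (f : mor X Y),
    exists (C : abelian_preadditive) (c : mor Y C), is_cokernel f c;
  mono_is_kernel : forall (K X : abelian_preadditive) (k : mor K X), is_mono k ->
    exists (Y : abelian_preadditive) (f : mor X Y), is_kernel f k;
  epi_is_cokernel : forall (X C : abelian_preadditive) (c : mor X C), is_epi c ->
    exists (Y : abelian_preadditive) (f : mor Y X), is_cokernel f c
}.

Section FiniteDirectSum.
Variables (A : preadditiveCat) (I : finType) (M_ : I -> A) (M : A).
Variable iota : forall i, mor (M_ i) M.

Lemma compm0l (X Y Z : A) (f : mor X Y) : (0 : mor Y Z) \c f = 0.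
Proof. by apply: (addrI ((0 : mor Y Z) \c f)); rewrite -compmDl !addr0. Qed.

Lemma compm0r (X Y Z : A) (g : mor Y Z) : g \c (0 : mor X Y) = 0.
Proof. by apply: (addrI (g \c (0 : mor X Y))); rewrite -compmDr !addr0. Qed.

Lemma compm_suml (X Y Z : A) (F : I -> mor Y Z) (f : mor X Y) :
  (\sum_i F i) \c f = \sum_i (F i \c f).
Proof.
by elim/big_rec2: _ => [|i u v _ <-]; rewrite ?compm0l ?compmDl.
Qed.

Lemma finite_coproduct_direct_sum : is_coproduct iota -> is_direct_sum iota.
Proof.
move=> cop; split=> // Z x y exy.
have projE i : exists p : mor M (M_ i), is_projection iota p.
  pose d j : mor (M_ j) (M_ i) :=
    if @eqP _ j i is ReflectT e then ecast k (mor (M_ j) (M_ k)) e (idmor (M_ j))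
    else 0.
  have [p [pd _]] := cop (M_ i) d; exists p; split=> [|j ji]; rewrite pd /d.
    by case: eqP => // e; rewrite eq_axiomK.
  by case: eqP.
have [p pP] := fin_all_exists projE.
have sum1 : \sum_i iota i \c p i = idmor M.
  have [g [_ guniq]] := cop M iota.
  rewrite -(guniq (idmor M)) => [|i]; last by rewrite compm1l.
  apply/esym/guniq => j; rewrite compm_suml (bigD1 j) //= -compmA (pP j).1 compm1r.
  rewrite big1 ?addr0 // => i /eqP ij.
  by rewrite -compmA (pP i).2 ?compm0r // => /esym.
rewrite -(compm1l x) -(compm1l y) -sum1 !compm_suml.
by apply: eq_bigr => i _; rewrite -!compmA (exy i (p i)).
Qed.

End FiniteDirectSum.

(* Main.v *)
(* In an abelian category, N is strongly self-regular exactly when its         *)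
(* endomorphism ring is strongly regular: every f has a commuting g with       *)
(* f g f = f.  If Ker f and Im f are summands, then f is invertible from a     *)
(* complement of Ker f onto Im f, which gives a quasi-inverse g; full          *)
(* invariance of the kernels of e and 1 - e makes every idempotent e central,  *)
(* whence f g = g f.  Conversely a strongly regular ring is reduced, so        *)
(* e = f g = g f is central, and Ker f = Ker e, Im f = Ker (1 - e).            *)
(* Strong regularity passes to corners p_i (End M) iota_i, and, the ring being *)
(* reduced, it kills the square-zero maps iota_j f p_i for i <> j.  When all   *)
(* off-diagonal components vanish, every endomorphism of M is diagonal and the *)
(* quasi-inverses of its diagonal entries assemble into one.                   *)
Require Import Defs.
From mathcomp Require Import all_boot all_order all_algebra.
From Stdlib Require Import Classical ClassicalEpsilon.
Import GRing.Theory.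
Local Open Scope ring_scope.

(** The bridge to rings is [strongly_self_regularP], resting on [summand_kernel_image_regular] in
    one direction and [is_kernel_central_idempotent] in the other. The theorem then becomes a block
    matrix argument on [End M]: [coproduct_strongly_regular] assembles the diagonal blocks, and the
    joint monicity in [is_direct_sum] shows that endomorphisms are diagonal. *)

Section StronglyRegular.
Set Implicit Arguments.
Unset Strict Implicit.
Variable A : preadditiveCat.
Implicit Types X Y Z K N : A.

Lemma compmBl X Y Z (g g' : mor Y Z) (f : mor X Y) :
  (g - g') \c f = g \c f - g' \c f.
Proof. by apply/eqP; rewrite eq_sym subr_eq -compmDl subrK. Qed.

Lemma compmBr X Y Z (g : mor Y Z) (f f' : mor X Y) :
  g \c (f - f') = g \c f - g \c f'.
Proof. by apply/eqP; rewrite eq_sym subr_eq -compmDr subrK. Qed.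

Lemma is_kernel_mono X Y K (f : mor X Y) (k : mor K X) :
  is_kernel f k -> is_mono k.
Proof.
move=> [fk0 kU] Z u v kuv.
have [|w [_ wU]] := kU Z (k \c v); first by rewrite compmA fk0 compm0l.
by rewrite -(wU u) // -(wU v).
Qed.

Lemma is_kernel_factor X Y K (f : mor X Y) (k : mor K X) Z (g : mor Z X) :
  is_kernel f k -> f \c g = 0 -> exists u, g = k \c u.
Proof. by move=> [_ kU] /kU[u [<- _]]; exists u. Qed.

Lemma is_cokernel_factor X Y C (f : mor X Y) (c : mor Y C) Z (g : mor Y Z) :
  is_cokernel f c -> g \c f = 0 -> exists u, g = u \c c.
Proof. by move=> [_ cU] /cU[u [<- _]]; exists u. Qed.

Lemma is_kernel_ext X Y Y' K (f : mor X Y) (f' : mor X Y') (k : mor K X) :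
  (forall Z (g : mor Z X), f \c g = 0 <-> f' \c g = 0) ->
  is_kernel f k -> is_kernel f' k.
Proof.
by move=> ff' [fk0 kU]; split=> [|Z g /ff'/kU //]; apply/ff'.
Qed.

Definition quasi_inverse N (f g : mor N N) := f \c g \c f = f /\ f \c g = g \c f.

Definition strongly_regular N := forall f : mor N N, exists g, quasi_inverse f g.

Lemma strongly_regular_square_zero N (f : mor N N) :
  strongly_regular N -> f \c f = 0 -> f = 0.
Proof.
move=> srN ff0; have [g [fgf fg]] := srN f.
by rewrite -fgf fg -compmA ff0 compm0r.
Qed.

(** The Peirce corners [e h (1 - e)] and [(1 - e) h e] square to zero, hence vanish. *)
Lemma strongly_regular_idempotent_central N (e h : mor N N) :
  strongly_regular N -> e \c e = e -> e \c h = h \c e.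
Proof.
move=> srN ee.
have eh : e \c h - e \c h \c e = 0.
  apply: strongly_regular_square_zero srN _.
  by rewrite !(compmBl, compmBr) !compmA -!(compmA _ e e) !ee !subrr.
have he : h \c e - e \c h \c e = 0.
  apply: strongly_regular_square_zero srN _.
  by rewrite !(compmBl, compmBr) !compmA -!(compmA _ e e) !ee !subrr.
by rewrite (subr0_eq eh) (subr0_eq he).
Qed.

End StronglyRegular.

Section Abelian.
Set Implicit Arguments.
Unset Strict Implicit.
Variable A : abelianCat.
Implicit Types X Y Z K N : A.

Lemma is_kernel_central_idempotent N K (e : mor N N) (k : mor K N) :
    e \c e = e -> (forall h, e \c h = h \c e) -> is_kernel e k ->
  is_direct_summand k /\ is_fully_invariant k.
Proof.
move=> ee eC kerk; have [ek0 _] := kerk; split; last first.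
  move=> h; apply: is_kernel_factor kerk _.
  by rewrite compmA eC -compmA ek0 compm0r.
(* The complement of [Ker e] is [Ker (1 - e)]; the projections are [1 - e] and [e], factored through
   these kernels. *)
have [L [l kerl]] := @has_kernels A _ _ (idmor N - e).
have le : e \c l = l.
  by case: kerl; rewrite compmBl compm1l => /subr0_eq.
have [p pE] : exists p, idmor N - e = k \c p.
  by apply: is_kernel_factor kerk _; rewrite compmBr compm1r ee subrr.
have [q qE] : exists q, e = l \c q.
  by apply: is_kernel_factor kerl _; rewrite compmBl compm1l ee subrr.
have k_mono := is_kernel_mono kerk; have l_mono := is_kernel_mono kerl.
exists L, l, p, q; split.
- by apply: k_mono; rewrite compmA -pE compmBl ek0 subr0 compm1l compm1r.
- by apply: l_mono; rewrite compmA -qE le compm1r.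
- by apply: k_mono; rewrite compmA -pE compmBl compm1l le subrr compm0r.
- by apply: l_mono; rewrite compmA -qE ek0 compm0r.
- by rewrite -pE -qE subrK.
Qed.

Lemma mono_epi_split_epi X Y (f : mor X Y) :
  is_mono f -> is_epi f -> exists g, f \c g = idmor Y.
Proof.
move=> /mono_is_kernel[Z [v kerf]] f_epi.
have v0 : v = 0 by apply: f_epi; rewrite (proj1 kerf) compm0l.
have [|g fg] := @is_kernel_factor _ _ _ _ _ _ _ (idmor Y) kerf.
  by rewrite v0 compm0l.
by exists g.
Qed.

(** If [t] equalizes [u] and [u'], then [f] factors through the subobject [m w], where [w] is the
    kernel of [u - u']. A morphism with kernel [m w] kills [f], hence factors through [c] and kills
    [m]; so [w] is split epi and [u = u']. *)
Lemma image_factor_epi X Y K (f : mor X Y) (m : mor K Y) (t : mor X K) :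
  is_image f m -> f = m \c t -> is_epi t.
Proof.
move=> [C [c [cokc kerm]]] fE Z u u' utu'.
have m_mono := is_kernel_mono kerm.
have [W [w kerw]] := @has_kernels A _ _ (u - u').
have [s tE] : exists s, t = w \c s.
  by apply: is_kernel_factor kerw _; rewrite compmBl utu' subrr.
have mw_mono : is_mono (m \c w).
  move=> V x y; rewrite -!compmA => /m_mono; exact: is_kernel_mono kerw _ _ _.
have [V [v kermw]] := mono_is_kernel mw_mono.
have [v' vE] : exists v', v = v' \c c.
  apply: is_cokernel_factor cokc _.
  by rewrite fE tE !compmA -(compmA v) (proj1 kermw) compm0l.
have [r mE] : exists r, m = m \c w \c r.
  apply: is_kernel_factor kermw _.
  by rewrite vE -compmA (proj1 kerm) compm0r.
have wr : w \c r = idmor K by apply: m_mono; rewrite compmA -mE compm1r.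
apply: subr0_eq; rewrite -(compm1r (u - u')) -wr compmA (proj1 kerw).
exact: compm0l.
Qed.

Lemma summand_kernel_image_regular X Y K J (f : mor X Y) (k : mor K X)
    (m : mor J Y) :
    is_kernel f k -> is_direct_summand k ->
    is_image f m -> is_direct_summand m ->
  exists g, f \c g \c f = f.
Proof.
move=> kerk [L [l [p [q [_ ql _ qk kplq]]]]] imm.
move=> [_ [_ [p' [_ [p'm _ _ _ _]]]]].
have [C [c [cokc kerm]]] := imm.
have m_mono := is_kernel_mono kerm.
have [t fE] := is_kernel_factor kerm (proj1 cokc).
have t_epi := image_factor_epi imm fE.
have tk0 : t \c k = 0.
  by apply: m_mono; rewrite compmA -fE (proj1 kerk) compm0r.
have tlq : t \c l \c q = t.
  by rewrite -[RHS]compm1r -kplq compmDr !compmA tk0 compm0l add0r.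
(* [t l] compares the complement [L] of [Ker f] with [Im f]; it is mono and epi, so it has a right
   inverse [r]. *)
have [|| r tlr] := @mono_epi_split_epi _ _ (t \c l).
- move=> Z u v tluv; apply: subr0_eq.
  have [|w lw] := @is_kernel_factor _ _ _ _ _ _ _ (l \c (u - v)) kerk.
    by rewrite fE -compmA (compmA t) compmBr tluv subrr compm0r.
  by rewrite -(compm1l (u - v)) -ql -compmA lw compmA qk compm0l.
- move=> Z u v utlv; apply: t_epi.
  by rewrite -tlq !compmA -!(compmA _ t) utlv.
exists (l \c r \c p').
rewrite fE -!compmA (compmA p') p'm compm1l (compmA t) (compmA (t \c l)) tlr.
by rewrite compm1l.
Qed.

Lemma strongly_self_regularP N : strongly_self_regular N <-> strongly_regular N.
Proof.
split=> [ssrN f | srN f].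
  have idemC (e h : mor N N) : e \c e = e -> e \c h = h \c e.
    (* By full invariance [Ker d = Im (1 - d)] is stable under [h].            *)
    have halfC (d : mor N N) : d \c d = d -> d \c h \c d = d \c h.
      move=> dd; have [K [k kerk]] := @has_kernels A _ _ d.
      have [_ /(_ h)[a hk]] := proj1 (ssrN d) K k kerk.
      have [b bE] : exists b, idmor N - d = k \c b.
        by apply: is_kernel_factor kerk _; rewrite compmBr compm1r dd subrr.
      apply/esym/subr0_eq; rewrite -{1}(compm1r (d \c h)) -compmBr bE.
      by rewrite -compmA (compmA h) hk !compmA (proj1 kerk) !compm0l.
    move=> ee; rewrite -(halfC e ee).
    (* For [1 - e], [halfC] yields the other half, [e h e = h e]. *)
    have := halfC (idmor N - e).
    rewrite !(compmBl, compmBr) !compm1l !compm1r ee subrr subr0 => /(_ erefl).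
    by move/eqP; rewrite -subr_eq0 addrAC subrr add0r oppr_eq0 subr_eq0 => /eqP.
  have [K [k kerk]] := @has_kernels A _ _ f.
  have [C [c cokc]] := @has_cokernels A _ _ f.
  have [J [m kerm]] := @has_kernels A _ _ c.
  have imm : is_image f m by exists C, c.
  have [[sumk _] [summ _]] := (proj1 (ssrN f) K k kerk, proj2 (ssrN f) J m imm).
  have [g fgf] := summand_kernel_image_regular kerk sumk imm summ.
  exists g; split=> //.
  (* Both idempotents commute with [f], so [f f g = f = g f f], whence [f g = g f f g = g f]. *)
  have fgC := idemC (f \c g); have gfC := idemC (g \c f).
  have ffg : f \c (f \c g) = f by rewrite -fgC ?fgf // compmA fgf.
  have gff : g \c f \c f = f by rewrite gfC ?compmA ?fgf // -!compmA (compmA f) fgf.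
  by rewrite -{1}gff -!compmA ffg.
have [g [fgf fg]] := srN f; set e := f \c g.
have ee : e \c e = e by rewrite /e compmA fgf.
have eC h : e \c h = h \c e by apply: strongly_regular_idempotent_central.
split=> [K k kerk | J m [C [c [cokc kerm]]]].
  apply: (@is_kernel_central_idempotent _ _ e) => //.
  apply: is_kernel_ext kerk => Z x; split=> [fx0 | ex0].
    by rewrite /e fg -compmA fx0 compm0r.
  by rewrite -fgf -/e eC -compmA ex0 compm0r.
apply: (@is_kernel_central_idempotent _ _ (idmor N - e)) => [|h|].
- by rewrite !(compmBl, compmBr) !compm1l !compm1r ee subrr subr0.
- by rewrite compmBl compmBr compm1l compm1r eC.
apply: is_kernel_ext kerm => Z x; split=> [cx0 | ].
  have [u ->] : exists u, idmor N - e = u \c c.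
    by apply: is_cokernel_factor cokc _; rewrite compmBl compm1l fgf subrr.
  by rewrite -compmA cx0 compm0r.
rewrite compmBl compm1l => /subr0_eq ->.
by rewrite /e !compmA (proj1 cokc) !compm0l.
Qed.

End Abelian.

Section Coproduct.
Set Implicit Arguments.
Unset Strict Implicit.
Variables (A : preadditiveCat) (I : Type) (M_ : I -> A) (M : A).
Variable iota : forall i, mor (M_ i) M.
Hypothesis cop : is_coproduct iota.

Lemma coproduct_ext Z (f g : mor M Z) :
  (forall i, f \c iota i = g \c iota i) -> f = g.
Proof.
move=> fg; have [h [_ hU]] := cop (fun i => g \c iota i).
by rewrite -(hU f) // -(hU g).
Qed.

Lemma coproduct_projection i : exists p, @is_projection A I M_ M iota i p.
Proof.
(* Equality on [I] is decided classically; proof irrelevance makes the transported identity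
   independent of the proof of [j = i]. *)
have dE j : exists d : mor (M_ j) (M_ i),
    (forall e : j = i,
       d = ecast k (mor (M_ j) (M_ k)) e (idmor (M_ j))) /\
    (j <> i -> d = 0).
  have [e | ne] := classic (j = i); last by exists 0.
  by exists (ecast k (mor (M_ j) (M_ k)) e (idmor (M_ j))); split=> // e';
    rewrite (proof_irrelevance _ e' e).
have [d dP] := all_sig (fun j => constructive_indefinite_description _ (dE j)).
have [p [pE _]] := cop d.
exists p; split=> [|j]; rewrite pE; last exact: (dP j).2.
by rewrite ((dP i).1 erefl).
Qed.

Lemma coproduct_strongly_regular :
    (forall f : mor M M, forall i, exists a, f \c iota i = iota i \c a) ->
  (forall i, strongly_regular (M_ i)) -> strongly_regular M.
Proof.
move=> diag srM f.
have gE i : exists g : mor (M_ i) M, exists a b,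
    [/\ f \c iota i = iota i \c a, g = iota i \c b & quasi_inverse a b].
  have [a fa] := diag f i; have [b abP] := srM i a.
  by exists (iota i \c b), a, b.
have [h hP] := all_sig (fun i => constructive_indefinite_description _ (gE i)).
have [g [gh _]] := cop h.
exists g; split; apply: coproduct_ext => i; have [a [b [fa hb [aba ab]]]] := hP i.
  by rewrite -!compmA fa (compmA g) gh hb !compmA fa -!compmA (compmA a) aba.
by rewrite -!compmA gh fa hb !compmA fa gh hb -!compmA ab.
Qed.

End Coproduct.

Theorem theorem3p7 (A : abelianCat) (I : Type) (M_ : I -> A) (M : A)
    (iota : forall i : I, mor (M_ i) M) (hM : is_direct_sum iota) :
  strongly_self_regular M <->
  (forall i : I, strongly_self_regular (M_ i)) /\
  (forall i j : I, i <> j -> forall f : mor (M_ i) (M_ j), f = 0).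
Proof.
have [cop joint_mono] := hM; split.
  move=> /strongly_self_regularP srM; split=> [i | i j ij f].
    apply/strongly_self_regularP => f.
    have [p [pi _]] := coproduct_projection cop i.
    (* [F] extends [f] by zero on the other summands; the corner of its quasi-inverse is one for
       [f]. *)
    pose F := iota i \c f \c p; have [G [FGF FG]] := srM F.
    have pF : p \c F = f \c p by rewrite !compmA pi compm1l.
    have Fi : F \c iota i = iota i \c f by rewrite -compmA pi compm1r.
    clearbody F; exists (p \c G \c iota i); split.
      have -> : f \c (p \c G \c iota i) \c f = p \c (F \c G \c F) \c iota i.
        by rewrite !compmA pF -!compmA Fi.
      by rewrite FGF pF -compmA pi compm1r.
    by rewrite !compmA -pF -!compmA -Fi (compmA F) FG -compmA.
  have [p [pi pj]] := coproduct_projection cop i.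
  have [q [qj _]] := coproduct_projection cop j.
  have F0 : iota j \c f \c p = 0.
    apply: strongly_regular_square_zero srM _.
    rewrite -compmA (compmA p) (compmA p) pj; last by move/esym.
    by rewrite !compm0l compm0r.
  rewrite -(compm1l f) -(compm1r (_ \c f)) -qj -pi -(compmA q) compmA -(compmA q).
  by rewrite F0 compm0r compm0l.
move=> [ssrM hom0]; apply/strongly_self_regularP.
apply: coproduct_strongly_regular => // [f i | i]; last exact/strongly_self_regularP.
have [p [pi pP]] := coproduct_projection cop i.
(* The witness is the diagonal entry of [f]; the components in [M_j] with [j <> i] vanish by
   [hom0]. *)
exists (p \c f \c iota i); apply: joint_mono => j q [qj qP].
have [ij | ij] := classic (i = j); last first.
  by rewrite (hom0 _ _ ij (q \c (f \c _))) compmA qP // compm0l.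
case: _ / ij q qj qP => q qi qP.
(* Joint monicity tests every projection [q] onto [M_i], but its values on the [iota k] determine
   it. *)
have -> : q = p.
  apply: (coproduct_ext cop) => k; have [-> | ki] := classic (k = i).
    by rewrite qi pi.
  by rewrite qP ?pP.
by rewrite !compmA pi compm1l.
Qed.
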